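(* Let $k$ be a field of characteristic zero, let $\mathfrak{a}$ and $\mathfrak{b}$ be abelian Lie algebras over $k$, and let $\mathfrak{g}=(\mathfrak{a},\mathfrak{b},\varphi,\Omega)$ be an extension of $\mathfrak{b}$ by $\mathfrak{a}$. If there exists an $e\in\mathfrak{b}$ such that $\varphi(e)\in\mathrm{End}(\mathfrak{a})$ is an isomorphism, then $\mathfrak{g}$ admits an LR-structure. In fact, in that case the product $$(a,x)\circ(b,y):=(\varphi(x)b+\omega(x,y),\,0),\qquad a,b\in\mathfrak{a},\ x,y\in\mathfrak{b},$$ where $\omega(x,y)=\varphi(e)^{-1}\varphi(x)\Omega(e,y)$, defines an LR-structure on $\mathfrak{g}$.
   Context: An LR-structure on a Lie algebra $\mathfrak{g}$ over $k$ is a bilinear product $\mathfrak{g}\times\mathfrak{g}\to\mathfrak{g}$, $(u,v)\mapsto u\circ v$, satisfying for all $u,v,w\in\mathfrak{g}$: $u\circ(v\circ w)=v\circ(u\circ w)$, $(u\circ v)\circ w=(u\circ w)\circ v$, and $[u,v]=u\circ v-v\circ u$. For abelian Lie algebras $\mathfrak{a},\mathfrak{b}$, the notation $\mathfrak{g}=(\mathfrak{a},\mathfrak{b},\varphi,\Omega)$ means the following. The map $\varphi\colon\mathfrak{b}\to\mathrm{End}(\mathfrak{a})$ is linear with $\varphi(x)\varphi(y)=\varphi(y)\varphi(x)$ for all $x,y\in\mathfrak{b}$; the map $\Omega\colon\mathfrak{b}\times\mathfrak{b}\to\mathfrak{a}$ is a skew-symmetric bilinear map with $\varphi(x)\Omega(y,z)-\varphi(y)\Omega(x,z)+\varphi(z)\Omega(x,y)=0$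 for all $x,y,z\in\mathfrak{b}$; and $\mathfrak{g}$ is the Lie algebra with underlying vector space $\mathfrak{a}\times\mathfrak{b}$ and bracket $[(a,x),(b,y)]=(\varphi(x)b-\varphi(y)a+\Omega(x,y),0)$ for $a,b\in\mathfrak{a}$, $x,y\in\mathfrak{b}$. *)

(* Defs.v *)
From HB Require Import structures.
From mathcomp Require Import all_boot all_algebra.

Set Implicit Arguments.
Unset Strict Implicit.
Unset Printing Implicit Defensive.

Import GRing.Theory.
Local Open Scope ring_scope.

(* Vector spaces over k are arbitrary lmodType's: no dimension is assumed
   to be finite. *)

HB.mixin Record Lmodule_isLieAlgebra (k : fieldType) (L : Type)
    of GRing.Lmodule k L := {
  lie : L -> L -> L;
  lie_linearl : forall v : L, linear (lie^~ v);
  lie_linearr : forall u : L, linear (lie u);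
  liexx : forall u : L, lie u u = 0;
  lie_jacobi : forall u v w : L,
    lie u (lie v w) + lie v (lie w u) + lie w (lie u v) = 0
}.

#[short(type="lieAlgType")]
HB.structure Definition LieAlgebra (k : fieldType) :=
  {L of GRing.Lmodule k L & Lmodule_isLieAlgebra k L}.

HB.mixin Record LieAlgebra_isAbelian (k : fieldType) (L : Type)
    of LieAlgebra k L := {
  lie_abelian : forall u v : L, lie u v = 0
}.

#[short(type="abelianLieAlgType")]
HB.structure Definition AbelianLieAlgebra (k : fieldType) :=
  {L of LieAlgebra k L & LieAlgebra_isAbelian k L}.

Record LR_structure (k : fieldType) (g : lieAlgType k) (op : g -> g -> g) :
    Prop := {
  LR_linearl : forall v : g, linear (op^~ v);
  LR_linearr : forall u : g, linear (op u);
  LR_left_comm : forall u v w : g, op u (op v w) = op v (op u w);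
  LR_right_comm : forall u v w : g, op (op u v) w = op (op u w) v;
  LR_lie : forall u v : g, lie u v = op u v - op v u
}.

Definition admits_LR_structure (k : fieldType) (g : lieAlgType k) : Prop :=
  exists op : g -> g -> g, LR_structure op.

(* The pair (phi, Omega) in g = (a, b, phi, Omega). *)
Record ext_data (k : fieldType) (a b : abelianLieAlgType k) := ExtData {
  phi : b -> {linear a -> a};
  Omega : b -> b -> a;
  phi_linear : forall (c : k) (x y : b) (v : a),
    phi (c *: x + y) v = c *: phi x v + phi y v;
  phi_comm : forall (x y : b) (v : a), phi x (phi y v) = phi y (phi x v);
  Omega_linearl : forall y : b, linear (Omega^~ y);
  Omega_linearr : forall x : b, linear (Omega x);
  Omega_skew : forall x y : b, Omega x y = - Omega y x;
  Omega_cocycle : forall x y z : b,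
    phi x (Omega y z) - phi y (Omega x z) + phi z (Omega x y) = 0
}.

(* The carrier a * b of g.  The characteristic is an argument because
   skew-symmetry of Omega only makes the bracket alternating when 2 is
   invertible. *)
Definition ext (k : fieldType) (k0 : [pchar k] =i pred0)
  (a b : abelianLieAlgType k) (D : ext_data a b) : Type := (a * b)%type.

Section ExtLieAlgebra.
Variables (k : fieldType) (k0 : [pchar k] =i pred0).
Variables (a b : abelianLieAlgType k) (D : ext_data a b).
Local Notation g := (ext k0 D).

HB.instance Definition _ := GRing.Lmodule.copy g (a * b)%type.

Definition ext_lie (u v : g) : g :=
  (phi D u.2 v.1 - phi D v.2 u.1 + Omega D u.2 v.2, 0).

Fact OmegaxxE (x : b) : Omega D x x = 0.
Proof.
have h : (2%:R : k) *: Omega D x x = 0.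
  by rewrite scaler_nat mulr2n {1}Omega_skew addNr.
have n2 : (2%:R : k) != 0 by rewrite ((pcharf0P k).1 k0).
by move/eqP: h; rewrite scaler_eq0 (negPf n2) /= => /eqP.
Qed.

Fact phi0 (v : a) : phi D 0 v = 0.
Proof.
have := phi_linear D 1 0 0 v; rewrite !scale1r addr0 => h.
by apply: (@addrI _ (phi D 0 v)); rewrite addr0 -h.
Qed.

Fact Omega0r (x : b) : Omega D x 0 = 0.
Proof.
have := Omega_linearr D x 1 0 0; rewrite !scale1r addr0 => h.
by apply: (@addrI _ (Omega D x 0)); rewrite addr0 -h.
Qed.

Fact ext_liexx (u : g) : ext_lie u u = 0.
Proof. by rewrite /ext_lie subrr OmegaxxE addr0. Qed.

Fact ext_lie_linearr (u : g) : linear (ext_lie u).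
Proof.
case: u => [p x] c [q y] [r z]; rewrite /ext_lie /=.
congr (_, _); last by rewrite /= scaler0 addr0.
rewrite /= linearP phi_linear Omega_linearr !scalerDr scalerN opprD.
by rewrite [X in X + _ = _]addrACA [LHS]addrACA.
Qed.

Fact ext_lie_skew (u v : g) : ext_lie u v = - ext_lie v u.
Proof.
rewrite /ext_lie; congr (_, _); last by rewrite /= oppr0.
by rewrite /= (Omega_skew D u.2) !opprD opprK; congr (_ + _); rewrite addrC.
Qed.

Fact ext_lie_linearl (v : g) : linear (ext_lie^~ v).
Proof.
move=> c u w; rewrite ext_lie_skew ext_lie_linearr opprD -scalerN.
by rewrite -(ext_lie_skew u) -(ext_lie_skew w).
Qed.

Fact ext_lie_jacobi (u v w : g) :
  ext_lie u (ext_lie v w) + ext_lie v (ext_lie w u) + ext_lie w (ext_lie u v)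
  = 0.
Proof.
case: u v w => [p x] [q y] [r z]; rewrite /ext_lie /=.
congr (_, _); last by rewrite /= !addr0.
rewrite /= !phi0 !Omega0r !subr0 !addr0 !linearD !linearN /=.
rewrite (phi_comm D y x) (phi_comm D z x) (phi_comm D z y).
have := Omega_cocycle D x y z.
rewrite (Omega_skew D z x) linearN /=.
move=> cocycle; rewrite [X in X + _ = _]addrACA [LHS]addrACA cocycle addr0.
by rewrite [X in X + _]addrC subrKA subrKA subrr.
Qed.

HB.instance Definition _ := Lmodule_isLieAlgebra.Build k g
  ext_lie_linearl ext_lie_linearr ext_liexx ext_lie_jacobi.

End ExtLieAlgebra.

(* inv_e stands for phi(e)^-1. *)
Definition ext_omega (k : fieldType) (a b : abelianLieAlgType k)
    (D : ext_data a b) (e : b) (inv_e : a -> a) (x y : b) : a :=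
  inv_e (phi D x (Omega D e y)).

Definition ext_LR_product (k : fieldType) (k0 : [pchar k] =i pred0)
    (a b : abelianLieAlgType k) (D : ext_data a b) (e : b) (inv_e : a -> a)
    (u v : ext k0 D) : ext k0 D :=
  (phi D u.2 v.1 + ext_omega D e inv_e u.2 v.2, 0).

(* Main.v *)
Require Import Defs.
From HB Require Import structures.
From mathcomp Require Import all_boot all_algebra.
Import GRing.Theory.
Local Open Scope ring_scope.

(** Write [psi] for the inverse of [phi e], so that the product is
    [(a, x) o (b, y) = (phi x b + psi (phi x (Omega e y)), 0)].

    Every product lies in [a * 0], and the left factor acts only through its
    component in [b].  Hence triple products [(u o v) o w] vanish, which
    settles right commutativity.  Left commutativity says that
    [phi x (phi y c) + phi x (psi (phi y (Omega e z)))] is symmetric in [x] and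
    [y]; this holds because the operators [phi x] commute with one another,
    hence also with [psi] ([can_comm]).

    Finally, [u o v - v o u] is the bracket exactly when
    [omega x y - omega y x = Omega x y].  Applying [phi e] turns this into the
    cocycle identity of [Omega] at the triple [e, x, y]
    ([ext_omega_antisym]). *)

Lemma can_comm {T : Type} {f f' g : T -> T} :
  cancel f f' -> cancel f' f -> (forall v, f (g v) = g (f v)) ->
  forall v, f' (g v) = g (f' v).
Proof. by move=> fK f'K fg v; apply: (canLR fK); rewrite fg f'K. Qed.

Section ExtLRProduct.

Variables (k : fieldType) (k0 : [pchar k] =i pred0).
Variables (a b : abelianLieAlgType k) (D : ext_data a b) (e : b).
Variable psi : a -> a.
Hypotheses (phiK : cancel (phi D e) psi) (psiK : cancel psi (phi D e)).

Local Notation omega := (ext_omega D e psi).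

Lemma phi_inv_linear : linear psi.
Proof. by move=> c v w; apply: (canLR phiK); rewrite linearP !psiK. Qed.

Lemma phi_inv0 : psi 0 = 0.
Proof. by apply: (canLR phiK); rewrite linear0. Qed.

Lemma phi_inv_comm (x : b) (v : a) : psi (phi D x v) = phi D x (psi v).
Proof. by apply: (can_comm phiK psiK) => w; apply: phi_comm. Qed.

Lemma ext_omega_linearl (y : b) : linear (omega^~ y).
Proof. by move=> c x x'; rewrite /ext_omega phi_linear phi_inv_linear. Qed.

Lemma ext_omega_linearr (x : b) : linear (omega x).
Proof.
by move=> c y y'; rewrite /ext_omega Omega_linearr linearP phi_inv_linear.
Qed.

Lemma ext_omega0l (y : b) : omega 0 y = 0.
Proof. by rewrite /ext_omega phi0 phi_inv0. Qed.

Lemma ext_omega0r (x : b) : omega x 0 = 0.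
Proof. by rewrite /ext_omega Omega0r linear0 phi_inv0. Qed.

Lemma phi_ext_omegaC (x y z : b) :
  phi D x (omega y z) = phi D y (omega x z).
Proof. by rewrite /ext_omega !phi_inv_comm phi_comm. Qed.

(** After applying [phi e], this is the cocycle identity at [e, x, y]. *)
Lemma ext_omega_antisym (x y : b) : omega x y - omega y x = Omega D x y.
Proof.
apply: (can_inj phiK); rewrite linearB /ext_omega !psiK.
by apply/esym/eqP; rewrite -subr_eq0 opprB addrCA addrC Omega_cocycle.
Qed.

Lemma ext_LR_product_LR :
  LR_structure (ext_LR_product (k0 := k0) (D := D) e psi).
Proof.
split.
- move=> [q y] c [p x] [p' x']; congr (_, _); last by rewrite /= scaler0 addr0.
  by rewrite /= phi_linear ext_omega_linearl scalerDr addrACA.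
- move=> [p x] c [q y] [q' y']; congr (_, _); last by rewrite /= scaler0 addr0.
  by rewrite /= linearP ext_omega_linearr scalerDr addrACA.
- move=> [p x] [q y] [r z]; congr (_, _) => /=.
  by rewrite !ext_omega0r !addr0 !linearD /= phi_comm phi_ext_omegaC.
- move=> [p x] [q y] [r z]; congr (_, _) => /=.
  by rewrite !phi0 !ext_omega0l.
- move=> [p x] [q y]; congr (_, _); last by rewrite /= subrr.
  by rewrite /= -ext_omega_antisym opprD addrACA.
Qed.

End ExtLRProduct.

Theorem proposition5p4 (k : fieldType) (k0 : [pchar k] =i pred0)
    (a b : abelianLieAlgType k) (D : ext_data a b) (e : b) :
  bijective (phi D e) ->
  admits_LR_structure (ext k0 D) /\
  forall inv_e : a -> a, cancel (phi D e) inv_e -> cancel inv_e (phi D e) ->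
    LR_structure (ext_LR_product (k0 := k0) (D := D) e inv_e).
Proof.
case=> psi phiK psiK; split; last by move=> inv_e; apply: ext_LR_product_LR.
by exists (ext_LR_product e psi); apply: ext_LR_product_LR.
Qed.
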